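(* Let $X$ be a strongly hyperbolic metric space. Then $X$ is a good hyperbolic space. If, moreover, $X$ is roughly geodesic, then $X$ is strongly bolic.
   Context: Notation: $|x,y|$ is the distance between points $x,y$ of a metric space $X$, and $(x,y)_o=\tfrac12\big(|x,o|+|y,o|-|x,y|\big)$ is the Gromov product with respect to $o\in X$. Strongly hyperbolic: $X$ is strongly hyperbolic with parameter $\epsilon>0$ if $\exp(-\epsilon (x,y)_o)\le \exp(-\epsilon (x,z)_o)+\exp(-\epsilon (z,y)_o)$ for all $x,y,z,o\in X$. $X$ is strongly hyperbolic if this holds for some parameter $\epsilon>0$. Hyperbolic: $X$ is $\delta$-hyperbolic ($\delta\ge 0$) if $(x,y)_o\ge \min\{(x,z)_o,(y,z)_o\}-\delta$ for all $x,y,z,o\in X$; it is hyperbolic if it is $\delta$-hyperbolic for some $\delta\ge0$. Boundary and bordification of a hyperbolic space $X$: a sequence $(x_i)$ in $X$ converges to infinity if $(x_i,x_j)_o\to\infty$ as $i,j\to\infty$; two such sequences $(x_i),(y_i)$ are equivalent if $(x_i,y_i)_o\to\infty$ as $i\to\infty$; these notions do not depend on $o\in X$. The Gromov boundary $\partial X$ is the set of equivalence classes, and a sequence converging to infinity is said to converge to its class. For $\xi,\xi'\in\partial X$ and $x\in X$ put $\langle \xi,\xi'\rangle_o=\inf\{\liminf (x_i,x_i')_o: x_i\to\xi, x'_i\to\xi'\}$ and $\langle x,\xi\rangle_o=\inf\{\liminf (x,x_i)_o: x_i\to\xi\}$. The bordification $X\cup\partial X$ carries the topology in which a set $O$ is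 open iff $O\cap X$ is open in $X$ and for every $\xi\in O\cap\partial X$ there is $n$ with $\{w\in X\cup\partial X:\langle w,\xi\rangle_o>n\}\subseteq O$. Good: a hyperbolic space $X$ is $\epsilon$-good ($\epsilon>0$) if for each basepoint $o\in X$: (i) the Gromov product $(\cdot,\cdot)_o$ on $X\times X$ extends to a continuous function $(X\cup\partial X)\times(X\cup\partial X)\to[0,\infty]$, still denoted $(\cdot,\cdot)_o$; and (ii) $\exp(-\epsilon(\cdot,\cdot)_o)$ is a metric on $\partial X$ (with $\exp(-\infty)=0$). $X$ is a good hyperbolic space if it is $\epsilon$-good for some $\epsilon>0$. Roughly geodesic: there is a constant $C\ge0$ such that for every $x,y\in X$ there is a (not necessarily continuous) map $\gamma:[a,b]\to X$ with $\gamma(a)=x$, $\gamma(b)=y$ and $|s-s'|-C\le|\gamma(s),\gamma(s')|\le|s-s'|+C$ for all $s,s'\in[a,b]$. Strongly bolic (in the form to which Lafforgue's definition amounts for roughly geodesic hyperbolic spaces): for every $\eta,r>0$ there exists $R>0$ such that, for all $x,y,z,t\in X$, $|x,y|+|z,t|\le r$ and $|x,z|+|y,t|\ge R$ imply $|x,t|+|y,z|\le|x,z|+|y,t|+\eta$. *)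

(* Defs.v *)
From HB Require Import structures.
From mathcomp Require Import all_boot all_order all_algebra.
From mathcomp Require Import all_classical all_reals all_analysis.
From mathcomp Require Import ring lra.

Set Implicit Arguments.
Unset Strict Implicit.
Unset Printing Implicit Defensive.

Import Order.TTheory GRing.Theory Num.Theory.
Import numFieldNormedType.Exports.

Local Open Scope classical_set_scope.
Local Open Scope ring_scope.

Definition gromov (R : realType) (X : metricType R) (o x y : X) : R :=
  (mdist x o + mdist y o - mdist x y) / 2.

Definition strongly_hyperbolic_with (R : realType) (eps : R)
    (X : metricType R) : Prop :=
  forall x y z o : X,
    expR (- (eps * gromov o x y)) <=
      expR (- (eps * gromov o x z)) + expR (- (eps * gromov o z y)).

Definition strongly_hyperbolic (R : realType) (X : metricType R) : Prop :=
  exists2 eps : R, 0 < eps & strongly_hyperbolic_with eps X.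

Definition hyperbolic_with (R : realType) (delta : R)
    (X : metricType R) : Prop :=
  forall x y z o : X,
    Num.min (gromov o x z) (gromov o y z) - delta <= gromov o x y.

Definition hyperbolic (R : realType) (X : metricType R) : Prop :=
  exists2 delta : R, 0 <= delta & hyperbolic_with delta X.

(* [cvg_infty_basepoint], [equiv_infty_basepoint] and [bord_open_basepoint]
   below show that the quantification over all basepoints in [cvg_infty],
   [equiv_infty] and [bord_open] amounts to fixing any one of them. *)
Definition cvg_infty_at (R : realType) (X : metricType R) (o : X)
    (u : nat -> X) : Prop :=
  gromov o (u ij.1) (u ij.2) @[ij --> (\oo, \oo)] --> +oo.

Definition cvg_infty (R : realType) (X : metricType R) (u : nat -> X) : Prop :=
  forall o : X, cvg_infty_at o u.

Definition equiv_infty_at (R : realType) (X : metricType R) (o : X)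
    (u v : nat -> X) : Prop :=
  gromov o (u i) (v i) @[i --> \oo] --> +oo.

Definition equiv_infty (R : realType) (X : metricType R)
    (u v : nat -> X) : Prop :=
  forall o : X, equiv_infty_at o u v.

(* A boundary point is an equivalence class, encoded as the set of the
   sequences in it; [converges_to u xi] is thus membership of u in xi. *)
Definition boundary (R : realType) (X : metricType R) : Type :=
  {xi : set (nat -> X) | exists u, cvg_infty u /\
     xi = [set v | cvg_infty v /\ equiv_infty u v]}.

Definition converges_to (R : realType) (X : metricType R)
  (u : nat -> X) (xi : boundary X) : Prop := sval xi u.

Definition bordification (R : realType) (X : metricType R) : Type :=
  (X + boundary X)%type.

Definition in_space (R : realType) (X : metricType R) (x : X) :
  bordification X := inl x.

Definition at_infty (R : realType) (X : metricType R) (xi : boundary X) :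
  bordification X := inr xi.

Definition bracket (R : realType) (X : metricType R) (o : X)
    (w : bordification X) (xi : boundary X) : \bar R :=
  match w with
  | inl x => ereal_inf [set l | exists2 u, converges_to u xi &
                         l = limn_einf (fun i => (gromov o x (u i))%:E)]
  | inr eta => ereal_inf [set l | exists u v,
                 [/\ converges_to u eta, converges_to v xi &
                     l = limn_einf (fun i => (gromov o (u i) (v i))%:E)]]
  end.

Definition bord_open_at (R : realType) (X : metricType R) (o : X)
    (O : set (bordification X)) : Prop :=
  open (@in_space R X @^-1` O) /\
  forall xi, O (at_infty xi) ->
    exists n : nat, [set w | (n%:R%:E < bracket o w xi)%E] `<=` O.

Definition bord_open (R : realType) (X : metricType R) :
    set_system (bordification X) :=
  [set O | forall o : X, bord_open_at o O].

Section BordificationTopology.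
Variables (R : realType) (X : metricType R).

Lemma bord_openT : bord_open [set: bordification X].
Proof.
move=> o; split; first by rewrite preimage_setT; exact: openT.
by move=> xi _; exists 0%N.
Qed.

Lemma bord_openI : setI_closed (@bord_open R X).
Proof.
move=> A B hA hB o; have [oA nA] := hA o; have [oB nB] := hB o.
split; first by rewrite preimage_setI; exact: openI.
move=> xi [/nA[m Am] /nB[n Bn]]; exists (maxn m n) => w /= mnw; split.
- by apply: Am => /=; apply: le_lt_trans mnw; rewrite lee_fin ler_nat leq_maxl.
- by apply: Bn => /=; apply: le_lt_trans mnw; rewrite lee_fin ler_nat leq_maxr.
Qed.

Lemma bord_open_bigU (I : Type) (f : I -> set (bordification X)) :
  (forall i, bord_open (f i)) -> bord_open (\bigcup_i f i).
Proof.
move=> hf o; split.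
  by rewrite preimage_bigcup; apply: bigcup_open => i _; exact: (hf i o).1.
move=> xi [i _ fi]; have [n fn] := (hf i o).2 xi fi.
by exists n => w /fn fw; exists i.
Qed.

HB.instance Definition _ := gen_eqMixin (bordification X).
HB.instance Definition _ := gen_choiceMixin (bordification X).
HB.instance Definition _ := isOpenTopological.Build (bordification X)
  bord_openT bord_openI bord_open_bigU.

End BordificationTopology.

Section Basepoint.
Variables (R : realType) (X : metricType R).
Implicit Types (o p x y : X) (u v : nat -> X) (xi : boundary X).

Lemma gromov_basepoint o p x y : gromov o x y - mdist o p <= gromov p x y.
Proof.
have hx := metric_triangle x p o; have hy := metric_triangle y p o.
by rewrite (metric_sym p o) in hx hy; rewrite /gromov; lra.
Qed.

Lemma gromov_basepoint_cvg o p (T : Type) (F : set_system T) (f g : T -> X) :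
  Filter F -> gromov o (f t) (g t) @[t --> F] --> +oo ->
  gromov p (f t) (g t) @[t --> F] --> +oo.
Proof.
move=> FF /cvgryPge h; apply/cvgryPge => A.
apply: filterS (h (A + mdist o p)) => t /=.
by have := gromov_basepoint o p (f t) (g t); lra.
Qed.

Lemma cvg_infty_basepoint o u : cvg_infty u <-> cvg_infty_at o u.
Proof. by split=> [/(_ o)|h p] //; exact: gromov_basepoint_cvg h. Qed.

Lemma equiv_infty_basepoint o u v : equiv_infty u v <-> equiv_infty_at o u v.
Proof. by split=> [/(_ o)|h p] //; exact: gromov_basepoint_cvg h. Qed.

Let limn_einf_basepoint o p (f g : nat -> X) :
  (- (mdist o p)%:E + limn_einf (fun i => (gromov o (f i) (g i))%:E) <=
   limn_einf (fun i => (gromov p (f i) (g i))%:E))%E.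
Proof.
rewrite -limn_einf_shift//= !limn_einf_lim.
apply: lee_lim; [exact: is_cvg_einfs|exact: is_cvg_einfs|].
apply: nearW => n; apply: le_ereal_inf_tmp => _ [i /= ni <-].
apply: (@le_trans _ _ (- (mdist o p)%:E + (gromov o (f i) (g i))%:E)%E).
  by apply: ereal_inf_lbound; exists i.
by rewrite -EFinN -EFinD lee_fin addrC gromov_basepoint.
Qed.

Lemma bracket_basepoint o p w xi :
  (- (mdist o p)%:E + bracket o w xi <= bracket p w xi)%E.
Proof.
case: w => [x|eta]; apply: le_ereal_inf_tmp => l.
- case=> u uxi ->; apply: le_trans (limn_einf_basepoint o p (fun=> x) u).
  by rewrite leeD2l//; apply: ereal_inf_lbound; exists u.
- case=> u [v [ueta vxi ->]]; apply: le_trans (limn_einf_basepoint o p u v).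
  by rewrite leeD2l//; apply: ereal_inf_lbound; exists u, v.
Qed.

Lemma bord_open_basepoint o (O : set (bordification X)) :
  bord_open O <-> bord_open_at o O.
Proof.
split=> [/(_ o)//|[oO hO] p]; split=> // xi /hO [n nO].
have [m hm] : exists m : nat, n%:R + mdist p o <= m%:R :> R.
  exists (Num.truncn (n%:R + mdist p o)).+1.
  by apply/ltW; rewrite truncnS_gt.
exists m => w /= mw; apply: nO => /=.
apply: lt_le_trans (bracket_basepoint p o w xi).
rewrite addeC lteBrDr//; apply: le_lt_trans mw.
by rewrite -EFinD lee_fin.
Qed.

End Basepoint.

Definition is_metric (R : realType) (T : Type) (d : T -> T -> R) : Prop :=
  [/\ forall x y, 0 <= d x y,
      forall x y, d x y = 0 <-> x = y,
      forall x y, d x y = d y x &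
      forall x y z, d x z <= d x y + d y z].

(* [expeR -oo = 0]; as 0 < eps and 0 <= g, the argument of [fine] is finite. *)
Definition exp_dist (R : realType) (X : metricType R) (eps : R)
    (g : bordification X * bordification X -> \bar R) (xi eta : boundary X) :
    R :=
  fine (expeR (- (eps%:E * g (at_infty xi, at_infty eta)))%E).

Definition good_with (R : realType) (eps : R) (X : metricType R) : Prop :=
  hyperbolic X /\
  forall o : X, exists g : bordification X * bordification X -> \bar R,
    [/\ continuous g,
        forall p, (0 <= g p)%E,
        forall x y, g (in_space x, in_space y) = (gromov o x y)%:E &
        is_metric (exp_dist eps g)].

Definition good_hyperbolic (R : realType) (X : metricType R) : Prop :=
  exists2 eps : R, 0 < eps & good_with eps X.

Definition roughly_geodesic (R : realType) (X : metricType R) : Prop :=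
  exists2 C : R, 0 <= C & forall x y : X,
    exists (a b : R) (gamma : R -> X),
      [/\ a <= b, gamma a = x, gamma b = y &
          forall s t, s \in `[a, b] -> t \in `[a, b] ->
            `|s - t| - C <= mdist (gamma s) (gamma t) <= `|s - t| + C].

Definition strongly_bolic (R : realType) (X : metricType R) : Prop :=
  forall eta r : R, 0 < eta -> 0 < r ->
    exists2 B : R, 0 < B & forall x y z t : X,
      mdist x y + mdist z t <= r -> B <= mdist x z + mdist y t ->
      mdist x t + mdist y z <= mdist x z + mdist y t + eta.

(* Main.v *)
Require Import Defs.
From mathcomp Require Import all_boot all_order all_algebra.
From mathcomp Require Import all_classical all_reals all_analysis.
From mathcomp Require Import lra.

Set Implicit Arguments.
Unset Strict Implicit.
Unset Printing Implicit Defensive.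

Import Order.TTheory GRing.Theory Num.Theory.
Import numFieldNormedType.Exports.

Local Open Scope classical_set_scope.
Local Open Scope ring_scope.

(** Fix a basepoint [o] and write V(x,y) = exp(-eps (x,y)_o) for the visual
    function.  Strong hyperbolicity says that V satisfies the triangle
    inequality.  It fails to be a metric only because V(x,x) > 0; but V does
    become a metric D once it is set to 0 on the diagonal, and the triangle
    inequality gives

      |V(x,y) - V(x',y')| <= D(x,x') + D(y,y')            ([visual_close]).

    A sequence converges to infinity exactly when V(u_i,u_j) -> 0, so such
    sequences are D-Cauchy, and so are constant ones.  Represent a point of X
    by a constant sequence and a boundary point by a sequence in its class;
    then V(u_i,v_i) is a Cauchy sequence of reals for any two representatives,
    and its limit extends V to the whole bordification ([visual_ext]).  The
    triangle inequality, symmetry and the bounds 0 <= V <= 1 pass to the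
    limit.  Between boundary points the limit vanishes iff the two
    representing sequences are equivalent, so the extension restricts to a
    metric on the boundary ([visual_ext_eq0]).

    Continuity of the extension is a form of equicontinuity: moving one
    argument slightly changes V little, uniformly in the other argument
    ([visual_ext_equicontinuous]).  Near a point x of X this holds because the
    Gromov product is 1-Lipschitz for the metric of X.  Near a boundary point
    xi the triangle inequality bounds the change by V(w,xi), so it is enough
    that the sublevel sets of V(-,xi) be open, which follows from the triangle
    inequality once more and from V(w,eta) <= exp(-eps <w,eta>_o)
    ([open_visual_ball]).  Finally the Gromov product itself is extended by
    -(1/eps) ln V, with ln 0 = -oo, which is continuous with values in the
    extended reals.

    Hyperbolicity follows from V(x,z) + V(z,y) <= 2 max(V(x,z), V(z,y)), with
    delta = (ln 2)/eps.  For strong bolicity, multiplying the strong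
    hyperbolicity inequality by a suitable exponential removes the basepoint:

      exp(eps/2 (|x,t| + |y,z|)) <=
        exp(eps/2 (|x,z| + |y,t|)) + exp(eps/2 (|x,y| + |z,t|)).

    If the last sum of distances is at most r and |x,z| + |y,t| is large, the
    last term is at most a small multiple of the previous one. *)

(** * Facts about exponential, logarithm and lower limits *)

Section Elementary.
Variable R : realType.
Implicit Types (a b e : R).

(** For a <= b factor out exp(-a) <= 1 and use 1 - u <= exp(-u). *)
Lemma expRN_lipschitz a b : 0 <= a -> 0 <= b ->
  `|expR (- a) - expR (- b)| <= `|a - b|.
Proof.
wlog ab : a b / a <= b => [h a0 b0|a0 b0].
  case: (leP a b) => [|/ltW] /h; first exact.
  by rewrite distrC (distrC a); apply.
rewrite ger0_norm ?subr_ge0 ?ler_expR ?lerN2// ler0_norm ?subr_le0// opprB.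
have -> : expR (- b) = expR (- a) * expR (- (b - a)).
  by rewrite -expRD; congr expR; lra.
have := expR_ge1Dx (- (b - a)); have := expR_gt0 (- a).
have : expR (- a) <= 1 by rewrite -expR0 ler_expR; lra.
have : expR (- (b - a)) <= 1 by rewrite -expR0 ler_expR; lra.
nra.
Qed.

(** At t > 0 this is the continuity of the real logarithm; at t <= 0 the value
    is -oo, and ln s <= A as soon as s < exp A. *)
Lemma continuous_lne_EFin : continuous (fun t : R => lne t%:E).
Proof.
move=> t; have [t0|t0] := ltP 0 t.
  rewrite /continuous_at lne_EFin//.
  have /near_eq_cvg h : \forall s \near t, (ln s)%:E = lne s%:E.
    near=> s; rewrite lne_EFin//; near: s; exact: lt_nbhsr.
  apply: cvg_trans h _; apply: cvg_EFin; first exact: nearW.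
  exact: continuous_ln.
rewrite /continuous_at le0_lneNy ?lee_fin//; apply/cvgeNyPle => A.
have : \forall s \near t, s < expR A.
  by apply: lt_nbhsl; apply: le_lt_trans t0 (expR_gt0 A).
apply: filterS => s sA; have [s0|s0] := ltP 0 s.
  by rewrite lne_EFin// lee_fin -(expRK A) ler_ln ?posrE ?expR_gt0// ltW.
by rewrite le0_lneNy ?lee_fin ?leNye.
Unshelve. all: by end_near. Qed.

Lemma limn_einf_gt_near (u : nat -> \bar R) (A : R) :
  (A%:E < limn_einf u)%E -> \forall i \near \oo, (A%:E <= u i)%E.
Proof.
rewrite limn_einf_lim => Au.
have := lte_lim (nondecreasing_einfs u) (@is_cvg_einfs _ u) Au.
apply: filterS => i /le_trans; apply.
by apply: ereal_inf_lbound; exists i => /=.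
Qed.

End Elementary.

(** * Elementary properties of the Gromov product *)

Section GromovProduct.
Variables (R : realType) (X : metricType R) (o : X).
Implicit Types x y : X.

Lemma gromovC x y : gromov o x y = gromov o y x.
Proof. by rewrite /gromov (metric_sym x y) (addrC (mdist x o)). Qed.

Lemma gromov_ge0 x y : 0 <= gromov o x y.
Proof.
have := metric_triangle x o y; rewrite (metric_sym o y) /gromov; lra.
Qed.

Lemma gromov_lipschitz x x' y :
  `|gromov o x y - gromov o x' y| <= mdist x x'.
Proof.
have := metric_triangle x x' o; have := metric_triangle x' x o.
have := metric_triangle x x' y; have := metric_triangle x' x y.
by rewrite (metric_sym x' x) ler_norml /gromov => *; apply/andP; split; lra.
Qed.

End GromovProduct.

(** * Sequences representing the points of the bordification *)

Section Representatives.
Variables (R : realType) (X : metricType R).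
Implicit Types (w : bordification X) (xi : boundary X).

(** One sequence per boundary point is enough: the topology of the
    bordification enters only through lower bounds on [bracket], an infimum
    which runs in particular over the chosen sequences. *)
Definition rep w : nat -> X :=
  match w with
  | inl x => fun=> x
  | inr xi => projT1 (cid (proj2_sig xi))
  end.

Lemma rep_infty xi : cvg_infty (rep (at_infty xi)) /\
  sval xi = [set v | cvg_infty v /\ equiv_infty (rep (at_infty xi)) v].
Proof. exact: projT2 (cid (proj2_sig xi)). Qed.

(** Restriction of the double limit to the diagonal. *)
Lemma cvg_infty_diag (u : nat -> X) : cvg_infty u -> equiv_infty u u.
Proof.
move=> + o => /(_ o) uoo.
apply/cvgryPge => A; have /cvgryPge/(_ A) [[P Q] /= [PP QQ] PQ] := uoo.
by apply: filterS2 PP QQ => i Pi Qi; exact: (PQ (i, i)).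
Qed.

Lemma rep_converges xi : converges_to (rep (at_infty xi)) xi.
Proof.
rewrite /converges_to; have [xi_oo ->] := rep_infty xi.
by split => //; exact: cvg_infty_diag.
Qed.

End Representatives.

(** * The visual function and its extension to the bordification *)

Section Visual.
Variables (R : realType) (X : metricType R) (eps : R) (o : X).
Hypothesis eps_gt0 : 0 < eps.
Hypothesis hX : strongly_hyperbolic_with eps X.
Implicit Types (x y z : X) (w : bordification X) (xi eta : boundary X).

Definition visual x y : R := expR (- (eps * gromov o x y)).

(** Since [visual] is positive, only the diagonal keeps it from being a
    metric; correcting the diagonal makes constant sequences Cauchy, so that
    points of X and of the boundary can be treated alike. *)
Definition visual_dist x y : R := if x == y then 0 else visual x y.

Lemma visualC x y : visual x y = visual y x.
Proof. by rewrite /visual gromovC. Qed.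

Lemma visual_le1 x y : visual x y <= 1.
Proof.
by rewrite /visual -expR0 ler_expR oppr_le0 mulr_ge0 ?gromov_ge0// ltW.
Qed.

Lemma visual_triangle x y z : visual x z <= visual x y + visual y z.
Proof. exact: hX. Qed.

(** Near a point of X smallness is measured by the metric of X, as [visual]
    does not become small there. *)
Lemma visual_lipschitz x x' y :
  `|visual x y - visual x' y| <= eps * mdist x x'.
Proof.
have pos u v : 0 <= eps * gromov o u v by rewrite mulr_ge0 ?gromov_ge0 ?ltW.
apply: le_trans (expRN_lipschitz (pos _ _) (pos _ _)) _.
by rewrite -mulrBr normrM gtr0_norm// ler_pM2l// gromov_lipschitz.
Qed.

Lemma visual_dist_le x y : visual_dist x y <= visual x y.
Proof. by rewrite /visual_dist; case: eqP => // _; exact: expR_ge0. Qed.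

(** The usual consequence of the triangle inequality that a metric is
    Lipschitz in each variable, except that the bounds are [visual_dist]:
    equal arguments contribute 0 and distinct ones contribute [visual]. *)
Lemma visual_close x x' y y' :
  `|visual x y - visual x' y'| <= visual_dist x x' + visual_dist y y'.
Proof.
have close1 u u' v : `|visual u v - visual u' v| <= visual_dist u u'.
  rewrite /visual_dist; case: eqP => [->|_]; first by rewrite subrr normr0.
  have := visual_triangle u u' v; have := visual_triangle u' u v.
  by rewrite (visualC u' u) ler_norml => *; apply/andP; split; lra.
apply: le_trans (ler_distD (visual x' y) _ _) _; apply: lerD => //.
by rewrite visualC (visualC x' y').
Qed.

(** Stated for an arbitrary filter so as to serve both for convergence to
    infinity, a double limit, and for equivalence of sequences. *)
Lemma cvgy_visual0 (T : Type) (F : set_system T) (f g : T -> X) :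
  Filter F ->
  gromov o (f t) (g t) @[t --> F] --> +oo <->
  visual (f t) (g t) @[t --> F] --> 0.
Proof.
move=> FF; split=> [/cvgryPge h|/cvgr0_norm_lt h].
  apply/cvgr0Pnorm_le => e e0.
  apply: filterS (h (- ln e / eps)) => t; rewrite ler_pdivrMr// => ht.
  rewrite ger0_norm ?expR_ge0// -[leRHS]lnK ?posrE// ler_expR.
  by rewrite mulrC; lra.
apply/cvgryPge => A; apply: filterS (h (expR (- (eps * A))) (expR_gt0 _)) => t.
by rewrite gtr0_norm ?expR_gt0// ltr_expR ltrN2 ltr_pM2l// => /ltW.
Qed.

(** A double limit at infinity equal to 0 is a Cauchy condition. *)
Lemma rep_cauchy w e : 0 < e -> exists N : nat, forall i j,
  (N <= i)%N -> (N <= j)%N -> visual_dist (rep w i) (rep w j) <= e.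
Proof.
case: w => [x|xi] e0.
  by exists 0%N => i j _ _; rewrite /visual_dist eqxx ltW.
have [/(_ o)/cvgy_visual0 h _] := rep_infty xi.
have /cvgr0Pnorm_le/(_ e e0) [[P Q] /= [[m _ mP] [n _ nQ]] PQ] := h _.
exists (maxn m n) => i j; rewrite !geq_max => /andP[mi _] /andP[_ nj].
apply: le_trans (visual_dist_le _ _) _; apply: le_trans (ler_norm _) _.
by apply: (PQ (i, j)); split; [exact: mP|exact: nQ].
Qed.

Definition visual_ext w w' : R := limn (fun i => visual (rep w i) (rep w' i)).

Lemma cvg_visual_ext w w' :
  visual (rep w i) (rep w' i) @[i --> \oo] --> visual_ext w w'.
Proof.
apply/cauchy_cvgP/cauchy_exP => e e0.
have e3 : 0 < e / 3 by rewrite divr_gt0.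
have [m hm] := rep_cauchy w e3; have [n hn] := rep_cauchy w' e3.
pose N := maxn m n.
exists (visual (rep w N) (rep w' N)); exists N => // i /= Ni.
apply: le_lt_trans (visual_close _ _ _ _) _.
have := hm N i (leq_maxl _ _) (leq_trans (leq_maxl _ _) Ni).
have := hn N i (leq_maxr _ _) (leq_trans (leq_maxr _ _) Ni).
by lra.
Qed.

Lemma visual_ext_ge0 w w' : 0 <= visual_ext w w'.
Proof.
apply: (cvgr_to_ge (@cvg_visual_ext w w')).
by apply: nearW => i; exact: expR_ge0.
Qed.

Lemma visual_ext_le1 w w' : visual_ext w w' <= 1.
Proof.
apply: (cvgr_to_le (@cvg_visual_ext w w')).
by apply: nearW => i; exact: visual_le1.
Qed.

Lemma visual_extC w w' : visual_ext w w' = visual_ext w' w.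
Proof. by rewrite /visual_ext; under eq_fun do rewrite visualC. Qed.

Lemma visual_ext_triangle w1 w2 w3 :
  visual_ext w1 w3 <= visual_ext w1 w2 + visual_ext w2 w3.
Proof.
have h : visual (rep w1 i) (rep w2 i) + visual (rep w2 i) (rep w3 i)
    @[i --> \oo] --> visual_ext w1 w2 + visual_ext w2 w3.
  by apply: cvgD; exact: cvg_visual_ext.
apply: (ler_cvg_to (@cvg_visual_ext w1 w3) h).
by apply: nearW => i; exact: visual_triangle.
Qed.

Lemma visual_ext_in_space x y :
  visual_ext (in_space x) (in_space y) = visual x y.
Proof.
apply: cvg_lim; first exact: norm_hausdorff.
exact: (cvg_cst (visual x y)).
Qed.

Lemma visual_ext_lipschitz x x' w :
  `|visual_ext (in_space x) w - visual_ext (in_space x') w| <= eps * mdist x x'.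
Proof.
have h : `|visual x (rep w i) - visual x' (rep w i)| @[i --> \oo] -->
    `|visual_ext (in_space x) w - visual_ext (in_space x') w|.
  apply: cvg_norm; apply: cvgB.
    exact: (@cvg_visual_ext (in_space x) w).
  exact: (@cvg_visual_ext (in_space x') w).
apply: (cvgr_to_le h); apply: nearW => i; exact: visual_lipschitz.
Qed.

(** The bracket is an infimum of lower limits over all representing
    sequences, hence bounds the lower limit along the chosen ones. *)
Lemma visual_ext_bracket (A : R) w xi : (A%:E < bracket o w xi)%E ->
  visual_ext w (at_infty xi) <= expR (- (eps * A)).
Proof.
move=> Aw; apply: (cvgr_to_le (@cvg_visual_ext w (at_infty xi))).
have : (A%:E < limn_einf (fun i =>
    (gromov o (rep w i) (rep (at_infty xi) i))%:E))%E.
  apply: lt_le_trans Aw _; case: w => [x|eta]; apply: ereal_inf_lbound.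
    by exists (rep (at_infty xi)); first exact: rep_converges.
  exists (rep (at_infty eta)), (rep (at_infty xi)).
  by split => //; exact: rep_converges.
move=> /limn_einf_gt_near; apply: filterS => i; rewrite lee_fin => Ai.
by rewrite /visual ler_expR lerN2 ler_pM2l.
Qed.

(** In terms of [visual], equivalence of sequences says that a quantity
    obeying the triangle inequality tends to 0; so it is symmetric and
    transitive, and equivalent representatives define the same class. *)
Lemma visual_ext_eq0 xi eta :
  visual_ext (at_infty xi) (at_infty eta) = 0 <-> xi = eta.
Proof.
have equivP (u v : nat -> X) :
    equiv_infty u v <-> visual (u i) (v i) @[i --> \oo] --> 0.
  by split=> [/(_ o)/cvgy_visual0|/cvgy_visual0 ?];
    [exact|exact/(equiv_infty_basepoint o)].
have [xi_oo xiE] := rep_infty xi; have [eta_oo etaE] := rep_infty eta.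
split=> [h|<-]; last first.
  apply/cvg_lim => //; exact/equivP/cvg_infty_diag.
set u := rep (at_infty xi) in xi_oo xiE *.
set v := rep (at_infty eta) in eta_oo etaE *.
have equiv_sym (f g : nat -> X) : equiv_infty f g -> equiv_infty g f.
  by move=> /equivP fg; apply/equivP; under eq_fun do rewrite visualC.
have equiv_trans (f g k : nat -> X) :
    equiv_infty f g -> equiv_infty g k -> equiv_infty f k.
  move=> /equivP fg /equivP gk; apply/equivP.
  have fgk : visual (f i) (g i) + visual (g i) (k i) @[i --> \oo] --> 0.
    by rewrite -[X in _ --> X]addr0; apply: cvgD.
  apply: (squeeze_cvgr _ (cvg_cst 0) fgk).
  by apply: nearW => i; rewrite expR_ge0 visual_triangle.
have uv : equiv_infty u v.
  by apply/equivP; rewrite -h; exact: cvg_visual_ext.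
apply: eq_sig_hprop => [? ? ?|/=]; first exact: Prop_irrelevance.
rewrite xiE etaE; apply/seteqP; split=> k [k_oo hk]; split=> //.
  exact: equiv_trans (equiv_sym _ _ uv) hk.
exact: equiv_trans uv hk.
Qed.

(** Around eta in the set, the triangle inequality leaves a margin d > 0: every
    w with V(w,eta) < d belongs to it, and V(w,eta) <= exp(-eps n) < d for all
    w with <w,eta>_o > n, if n is large.  At points of X the set is open
    because V is Lipschitz there. *)
Lemma open_visual_ball xi e : open [set w | visual_ext w (at_infty xi) < e].
Proof.
apply/(bord_open_basepoint o); split=> [|eta /= etae].
  rewrite openE => x /= xe.
  have d0 : 0 < (e - visual_ext (in_space x) (at_infty xi)) / eps.
    by rewrite divr_gt0// subr_gt0.
  apply: filterS (nbhsx_ballx x _ d0) => x'.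
  rewrite ballEmdist /= ltr_pdivlMr// mulrC => xx'.
  have := visual_ext_lipschitz x x' (at_infty xi); rewrite ler_norml.
  by move=> /andP[h _]; rewrite /preimage /=; lra.
set d := e - visual_ext (at_infty eta) (at_infty xi).
have d0 : 0 < d by rewrite /d; lra.
(* exp(-eps n) < d as soon as n > -(ln d)/eps *)
pose n := (Num.truncn (- ln d / eps)).+1; exists n => w /= nw.
apply: le_lt_trans (visual_ext_triangle w (at_infty eta) _) _.
rewrite -ltrBrDr -/d; apply: le_lt_trans (visual_ext_bracket nw) _.
rewrite -[ltRHS]lnK ?posrE// ltr_expR.
have : - ln d / eps < n%:R by exact: truncnS_gt.
by rewrite ltr_pdivrMr// mulrC; lra.
Qed.

(** Uniformity in the second argument is what turns separate into joint
    continuity. *)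
Lemma visual_ext_equicontinuous w e : 0 < e ->
  \forall w1 \near w, forall w', `|visual_ext w w' - visual_ext w1 w'| <= e.
Proof.
move=> e0; case: w => [x|xi].
  (* X is open in the bordification, so the image of an open part of the ball
     is a neighborhood of x there *)
  have ball_x : nbhs x (ball x (e / eps)).
    by apply: nbhsx_ballx; rewrite divr_gt0.
  have : \forall w1 \near (in_space x : bordification X),
      exists2 x1, w1 = in_space x1 & (ball x (e / eps))° x1.
    apply: open_nbhs_nbhs; split; last by exists x.
    apply/(bord_open_basepoint o); split=> [|xi [x1 //]].
    rewrite (_ : _ @^-1` _ = (ball x (e / eps))°); first exact: open_interior.
    by apply/seteqP; split=> [x1 [_ [->]]|x1 h] //=; exists x1.
  apply: filterS => _ [x1 -> /interior_subset xx1] w'.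
  apply: le_trans (visual_ext_lipschitz _ _ _) _.
  move: xx1; rewrite ballEmdist /= => /ltW.
  by rewrite ler_pdivlMr// (mulrC eps).
have : \forall w1 \near (at_infty xi : bordification X),
    visual_ext w1 (at_infty xi) < e.
  apply: open_nbhs_nbhs; split; first exact: open_visual_ball.
  by rewrite /= (visual_ext_eq0 xi xi).2.
apply: filterS => w1 w1e w'.
have := visual_ext_triangle (at_infty xi) w1 w'.
have := visual_ext_triangle w1 (at_infty xi) w'.
rewrite (visual_extC (at_infty xi) w1) ler_norml => *.
by apply/andP; split; rewrite -/(at_infty xi); lra.
Qed.

Lemma continuous_visual_ext :
  continuous (fun p : bordification X * bordification X =>
                visual_ext p.1 p.2).
Proof.
move=> [w w']; apply/cvgrPdist_le => e e0.
have e2 : 0 < e / 2 by rewrite divr_gt0.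
exists ([set w1 | forall w', `|visual_ext w w' - visual_ext w1 w'| <= e / 2],
  [set w1' | forall w, `|visual_ext w' w - visual_ext w1' w| <= e / 2]).
  by split; exact: visual_ext_equicontinuous.
move=> [w1 w1'] /= [/(_ w') h /(_ w1) h'].
apply: le_trans (ler_distD (visual_ext w1 w') _ _) _.
by move: h'; rewrite (visual_extC w') (visual_extC w1'); lra.
Qed.

Definition gromov_ext (p : bordification X * bordification X) : \bar R :=
  (eps^-1%:E * - lne (visual_ext p.1 p.2)%:E)%E.

Lemma continuous_gromov_ext : continuous gromov_ext.
Proof.
move=> p; apply: cvgeZl => //; apply: cvgeN.
apply: (continuous_comp (f := fun q => visual_ext q.1 q.2)
                        (g := fun t : R => lne t%:E)).
  exact: continuous_visual_ext.
exact: continuous_lne_EFin.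
Qed.

Lemma gromov_ext_ge0 p : (0 <= gromov_ext p)%E.
Proof.
apply: mule_ge0; first by rewrite lee_fin invr_ge0 ltW.
by rewrite oppe_ge0 lne_le0 lee_fin visual_ext_le1.
Qed.

Lemma gromov_ext_in_space x y :
  gromov_ext (in_space x, in_space y) = (gromov o x y)%:E.
Proof.
rewrite /gromov_ext visual_ext_in_space lne_EFin ?expR_gt0//.
rewrite expRK -EFinN opprK -EFinM mulKf//; exact: lt0r_neq0.
Qed.

Lemma exp_dist_gromov_ext xi eta :
  exp_dist eps gromov_ext xi eta = visual_ext (at_infty xi) (at_infty eta).
Proof.
rewrite /exp_dist /gromov_ext muleA -EFinM divff ?lt0r_neq0// mul1e oppeK.
by rewrite lneK// in_itv /= lee_fin visual_ext_ge0 leey.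
Qed.

Lemma exp_dist_is_metric : is_metric (exp_dist eps gromov_ext).
Proof.
split=> [xi eta|xi eta|xi eta|xi eta zeta]; rewrite !exp_dist_gromov_ext.
- exact: visual_ext_ge0.
- exact: visual_ext_eq0.
- exact: visual_extC.
- exact: visual_ext_triangle.
Qed.

End Visual.

(** * Hyperbolicity and strong bolicity *)

Section StronglyHyperbolic.
Variables (R : realType) (X : metricType R) (eps : R).
Hypothesis eps_gt0 : 0 < eps.
Hypothesis hX : strongly_hyperbolic_with eps X.

(** Both terms on the right of the strong hyperbolicity inequality are at most
    exp(-eps m), with m the smaller Gromov product, and 2 = exp(ln 2). *)
Lemma strongly_hyperbolic_hyperbolic : hyperbolic X.
Proof.
exists (ln 2 / eps); first by rewrite divr_ge0 ?ln_ge0 ?ltW//; lra.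
move=> x y z o; set m := Num.min _ _.
have mx : eps * m <= eps * gromov o x z by rewrite ler_pM2l// ge_min lexx.
have my : eps * m <= eps * gromov o z y.
  by rewrite gromovC ler_pM2l// ge_min lexx orbT.
have h : expR (- (eps * gromov o x y)) <= expR (ln 2 - eps * m).
  apply: le_trans (hX x y z o) _; rewrite expRD lnK ?posrE//.
  rewrite mulr_natl mulr2n.
  by apply: lerD; rewrite ler_expR lerN2.
have ln2E : eps * (ln 2 / eps) = ln 2 by rewrite mulrC divfK// lt0r_neq0.
rewrite lerBlDr -(ler_pM2l eps_gt0) mulrDr ln2E.
by move: h; rewrite ler_expR; lra.
Qed.

(** Strong hyperbolicity for the products (x,t)_y, (x,z)_y, (z,t)_y,
    multiplied by exp(eps/2 (|x,y| + |z,y| + |t,y|)): the terms depending on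
    the basepoint y combine into distances between the four points. *)
Lemma strongly_hyperbolic_four_point (x y z t : X) :
  expR (eps / 2 * (mdist x t + mdist y z)) <=
  expR (eps / 2 * (mdist x z + mdist y t)) +
  expR (eps / 2 * (mdist x y + mdist z t)).
Proof.
pose c := eps / 2 * (mdist x y + mdist z y + mdist t y).
have := hX x t z y; rewrite -(ler_pM2l (expR_gt0 c)) mulrDr -!expRD.
rewrite /c /gromov (metric_sym y z) (metric_sym y t).
congr (_ <= _ + _); congr expR; lra.
Qed.

(** With e2 = eps/2 and S = |x,z| + |y,t|, the four-point inequality bounds
    exp(e2 (|x,t| + |y,z|)) by exp(e2 S) + exp(e2 r).  The bound on S is such
    that exp(e2 r) <= exp(e2 S) e2 eta, and 1 + e2 eta <= exp(e2 eta). *)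
Lemma strongly_hyperbolic_bolic : strongly_bolic X.
Proof.
move=> eta r eta0 r0; set e2 := eps / 2.
have e20 : 0 < e2 by rewrite divr_gt0.
have d0 : 0 < e2 * eta by rewrite mulr_gt0.
exists (Num.max 1 (r - ln (e2 * eta) / e2)); first by rewrite lt_max ltr01.
move=> x y z t near far; set S := mdist x z + _ in far *.
have S_far : e2 * r <= e2 * S + ln (e2 * eta).
  have lnE : e2 * (ln (e2 * eta) / e2) = ln (e2 * eta).
    by rewrite mulrC divfK// lt0r_neq0.
  move: far; rewrite ge_max => /andP[_].
  by rewrite -(ler_pM2l e20) mulrBr lnE; lra.
suff : e2 * (mdist x t + mdist y z) <= e2 * (S + eta) by rewrite ler_pM2l.
rewrite -ler_expR; apply: le_trans (strongly_hyperbolic_four_point x y z t) _.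
rewrite -/e2 -/S [e2 * (S + eta)]mulrDr [leRHS]expRD.
apply: (@le_trans _ _ (expR (e2 * S) * (1 + e2 * eta))).
  have -> : expR (e2 * S) * (1 + e2 * eta) =
      expR (e2 * S) + expR (e2 * S + ln (e2 * eta)).
    by rewrite mulrDr mulr1 expRD lnK ?posrE.
  rewrite lerD2l ler_expR.
  by apply: le_trans S_far; rewrite ler_pM2l.
by rewrite ler_pM2l ?expR_gt0// expR_ge1Dx.
Qed.

End StronglyHyperbolic.

Theorem theorem1p1 (R : realType) (X : metricType R)
  (hX : strongly_hyperbolic X) :
  good_hyperbolic X /\ (roughly_geodesic X -> strongly_bolic X).
Proof.
have [eps eps0 hXeps] := hX; split; last first.
  by move=> _; exact: strongly_hyperbolic_bolic hXeps.
exists eps => //; split; first exact: strongly_hyperbolic_hyperbolic hXeps.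
move=> o; exists (gromov_ext eps o); split.
- exact: continuous_gromov_ext.
- exact: gromov_ext_ge0.
- exact: gromov_ext_in_space.
- exact: exp_dist_is_metric.
Qed.
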